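(* There exists a universal constant $K<\infty$ such that the following holds. Let $m\in\mathbb{N}$, $m\le n$, $p>1$, and, for all $\mathbf{i}=(i_1,\dots,i_m)\in\{1,\dots,n\}^m$, let $h_{\mathbf{i}}:S^m\to\mathbb{R}$ be a nonnegative measurable function of $m$ variables whose $p$-th power is integrable for the law of $\mathbf{X}_{\mathbf{i}}=(X_{i_1}^{(1)},\dots,X_{i_m}^{(m)})$. Then $$\max_{J\subseteq\{1,\dots,m\}}\Bigl[\sum_{\mathbf{i}_J}E_J\Bigl(\sum_{\mathbf{i}_{J^c}}E_{J^c}h_{\mathbf{i}}\Bigr)^p\Bigr]\le E\Bigl(\sum_{\mathbf{i}}h_{\mathbf{i}}\Bigr)^p\le (2e^2)^{mp}\sum_{J\subseteq\{1,\dots,m\}}\Bigl[p^{|J|p}\sum_{\mathbf{i}_J}E_J\Bigl(\sum_{\mathbf{i}_{J^c}}E_{J^c}h_{\mathbf{i}}\Bigr)^p\Bigr],$$ and also $$E\Bigl(\sum_{\mathbf{i}}h_{\mathbf{i}}\Bigr)^p\le K^{mp}\Bigl(\frac{p}{\log p}\Bigr)^{mp}\max_{J\subseteq\{1,\dots,m\}}\Bigl[\sum_{\mathbf{i}_J}E_J\Bigl(\sum_{\mathbf{i}_{J^c}}E_{J^c}h_{\mathbf{i}}\Bigr)^p\Bigr].$$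
   Context: The random variables $X_i^{(j)}$, $1\le i\le n$, $1\le j\le m$, $m\le n$, are independent (not necessarily with the same distribution) and take values in a measurable space $(S,\mathcal{S})$. Inside expectations and sums, $h_{\mathbf{i}}$ stands for the random variable $h_{i_1,\dots,i_m}(X_{i_1}^{(1)},\dots,X_{i_m}^{(m)})$, and $\sum_{\mathbf{i}}$ is the sum over all $\mathbf{i}\in\{1,\dots,n\}^m$. For $J\subseteq\{1,\dots,m\}$ ($J=\emptyset$ allowed), $J^c$ is its complement in $\{1,\dots,m\}$; $\mathbf{i}_J\in\{1,\dots,n\}^{|J|}$ is obtained from $\mathbf{i}$ by deleting the coordinates in places not in $J$; $\sum_{\mathbf{i}_J}$ is the sum over $1\le i_j\le n$, $j\in J$ (the coordinates not in $J$ being fixed), with $\sum_{\mathbf{i}_\emptyset}a=a$. $E$ is expectation with respect to all variables; $E_J$ is expectation only with respect to the variables $X_i^{(j)}$ with $j\in J$, $1\le i\le n$ (the others being held fixed), with $E_\emptyset a=a$. *)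

(* Defs.v *)
From HB Require Import structures.
From mathcomp Require Export all_boot all_order all_algebra.
From mathcomp Require Export all_classical all_reals all_analysis.
Set Implicit Arguments.
Unset Strict Implicit.
Unset Printing Implicit Defensive.
Import Order.TTheory GRing.Theory Num.Theory.

Local Open Scope classical_set_scope.
Local Open Scope ring_scope.

Section independence.
Context d (Omega : measurableType d) (R : realType) (P : probability Omega R).
Context d' (S : measurableType d') (I : finType).

Definition mutually_independent (X : I -> {RV P >-> S}) : Prop :=
  forall (K : {set I}) (A : I -> set S),
    (forall k, measurable (A k)) ->
    P (\bigcap_(k in [set` K]) (X k @^-1` A k)) =
    (\prod_(k in K) P (X k @^-1` A k))%E.

End independence.

Section decoupled_variables.
Context d (Omega : measurableType d) (R : realType) (P : probability Omega R).
Context d' (S : measurableType d') (n m : nat).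

(* In all doubly indexed arrays below, [x k j] is the value of the variable
   with lower index k (in 1..n) and upper index j (in 1..m). *)
Implicit Types (X : 'I_n -> 'I_m -> {RV P >-> S}) (x y : 'I_n -> 'I_m -> S).
Implicit Types (i : m.-tuple 'I_n) (J : {set 'I_m}).

Definition select i x : m.-tuple S := [tuple x (tnth i j) j | j < m].

Definition rv_vector X i (w : Omega) : m.-tuple S :=
  select i (fun k j => X k j w).

Lemma measurable_rv_vector X i : measurable_fun setT (rv_vector X i).
Proof.
apply/measurable_fun_tnthP => j.
have -> : @tnth m S ^~ j \o rv_vector X i = X (tnth i j) j.
  by apply/funext => w /=; rewrite tnth_mktuple.
exact: measurable_funP.
Qed.

HB.instance Definition _ X i :=
  isMeasurableFun.Build _ _ _ _ (rv_vector X i) (measurable_rv_vector X i).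

Definition del_coords J i : {ffun {j : 'I_m | j \in J} -> 'I_n} :=
  [ffun u => tnth i (val u)].

(* Expectation with respect to the columns j \in J only, the variables in the
   other columns being held fixed at the values given by [x]: since all the
   variables are independent, this is the integral against the joint law of
   the columns in J.  The result depends on [x] through its columns outside J
   only. *)
Definition partial_expectation X J (F : ('I_n -> 'I_m -> S) -> \bar R) x :
    \bar R :=
  (\int[P]_w F (fun k j => if j \in J then X k j w else x k j))%E.

Variables (X : 'I_n -> 'I_m -> {RV P >-> S}) (p : R).
Variable h : m.-tuple 'I_n -> m.-tuple S -> R.

(* The bracket attached to J.  The multi-index a plays the role of i_J, and
   the inner sum, over all i with i_J = a, is the sum over the remaining
   coordinates.  The value does not depend on [x]: the inner expectation
   integrates the columns outside J, the outer one the columns in J. *)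
Definition bracket J x : \bar R :=
  (\sum_(a : {ffun {j : 'I_m | j \in J} -> 'I_n})
     partial_expectation X J (fun y =>
       (\sum_(i : m.-tuple 'I_n | del_coords J i == a)
          partial_expectation X (~: J) (fun z => (h i (select i z))%:E) y)
       `^ p) x)%E.

End decoupled_variables.

(* Main.v *)
From HB Require Import structures.
Require Import Defs.
From mathcomp Require Import all_boot all_order all_algebra.
From mathcomp Require Import all_classical all_reals all_analysis.
From mathcomp Require Import measurable_realfun ring lra.
Import Order.TTheory GRing.Theory Num.Theory.
Local Open Scope classical_set_scope.
Local Open Scope ring_scope.

(* Idea. For a single column, write S for the sum of the nonnegative independent
   variables xi_k.  Expanding S^p as the sum of the xi_k S^(p-1) and splitting
   S = xi_k + S_k, with S_k independent of xi_k, by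
     (a + b)^(p-1) <= (1 + s)^(p-1) a^(p-1) + (1 + 1/s)^(p-1) b^(p-1)
   gives
     E S^p <= (1+s)^(p-1) E S E S^(p-1) + (1 + 1/s)^(p-1) sum_k E xi_k^p,
   and the factor E S^(p-1) is absorbed into the left-hand side by the pointwise bound
   c S^(p-1) <= S^p + c^p.  The choices s = 1/(p-1) and s = log p / (2p) produce the
   constants of the two upper bounds.  For m columns, the one-column bound is applied
   conditionally, one column after the other; each column is thereby either summed and
   averaged inside the power, or pulled out of it.  The lower bound is Jensen's
   inequality followed by the superadditivity of t^p.
   All kernels take values in [0, +oo], so that no integrability has to be tracked. *)

Set Implicit Arguments.
Unset Strict Implicit.
Unset Printing Implicit Defensive.

(** * Powers of extended reals *)

Section extended_powers.
Context {R : realType}.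
Implicit Types (x y c : \bar R) (p q s : R).
Local Open Scope ereal_scope.

Lemma ge0_le_poweR p x y : (0 <= p)%R -> 0 <= x -> x <= y -> x `^ p <= y `^ p.
Proof.
move=> p0 x0 xy; apply: gt0_ler_poweR => //; rewrite in_itv/= leey andbT//.
exact: le_trans xy.
Qed.

Lemma mule_poweRB1 p x : (1 < p)%R -> 0 <= x -> x * x `^ (p - 1) = x `^ p.
Proof.
move=> p1; case: x => [x|_|//]; last first.
  by rewrite !poweRyr ?subr_eq0 ?gt_eqF// ?mulyy// (lt_trans ltr01).
by rewrite lee_fin => x0; rewrite !poweR_EFin -EFinM mulr_powRB1// (lt_trans ltr01).
Qed.

(* Compare [y] with [s x]: the larger of the two controls the sum. *)
Lemma poweR_add_le q s x y : (0 < q)%R -> (0 < s)%R -> 0 <= x -> 0 <= y ->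
  (x + y) `^ q <= ((1 + s) `^ q)%:E * x `^ q + ((1 + s^-1) `^ q)%:E * y `^ q.
Proof.
move=> q0 s0 x0 y0.
have s1 : (0 < 1 + s)%R by rewrite addr_gt0.
have s2 : (0 < 1 + s^-1)%R by rewrite addr_gt0// invr_gt0.
have -> : ((1 + s) `^ q)%:E = (1 + s)%:E `^ q by rewrite poweR_EFin.
have -> : ((1 + s^-1) `^ q)%:E = (1 + s^-1)%:E `^ q by rewrite poweR_EFin.
rewrite -!poweRM ?lee_fin ?(ltW s1) ?(ltW s2)//.
have [ysx|sxy] := leP y (s%:E * x).
- apply: (@le_trans _ _ (((1 + s)%:E * x) `^ q)); last by rewrite leeDl// poweR_ge0.
  apply: ge0_le_poweR; [exact: ltW|exact: adde_ge0|].
  by rewrite EFinD ge0_muleDl ?lee_fin ?(ltW s0)// mul1e leeD2l.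
- apply: (@le_trans _ _ (((1 + s^-1)%:E * y) `^ q)); last by rewrite leeDr// poweR_ge0.
  apply: ge0_le_poweR; [exact: ltW|exact: adde_ge0|].
  rewrite EFinD ge0_muleDl ?lee_fin ?invr_ge0 ?(ltW s0)// mul1e addeC leeD2l//.
  by rewrite lee_pdivlMl// ltW.
Qed.

(** In use, [x] is one summand and [y] the sum of the others: the first product then has independent
    factors, and the second is a power of the summand alone. *)
Lemma mule_poweR_add_le p s x y : (1 < p)%R -> (0 < s)%R -> 0 <= x -> 0 <= y ->
  x * (y + x) `^ (p - 1) <= ((1 + s) `^ (p - 1))%:E * (x * y `^ (p - 1)) +
                            ((1 + s^-1) `^ (p - 1))%:E * x `^ p.
Proof.
move=> p1 s0 x0 y0.
have q0 : (0 < p - 1)%R by rewrite subr_gt0.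
apply: le_trans (lee_wpmul2l x0 (poweR_add_le q0 s0 y0 x0)) _.
rewrite ge0_muleDr ?mule_ge0 ?poweR_ge0 ?lee_fin ?powR_ge0//.
by rewrite muleCA [X in _ + X <= _]muleCA mule_poweRB1.
Qed.

(** The product is at most the [p]-th power of the larger of [c] and [x]. This trades a moment of
    order [p - 1] for one of order [p]. *)
Lemma mule_poweR_le p c x : (1 < p)%R -> 0 <= c -> 0 <= x ->
  c * x `^ (p - 1) <= x `^ p + c `^ p.
Proof.
move=> p1 c0 x0; have q0 : (0 <= p - 1)%R by rewrite subr_ge0 ltW.
have [cx|/ltW xc] := leP c x.
- apply: (@le_trans _ _ (x `^ p)); last by rewrite leeDl ?poweR_ge0.
  by rewrite -[leRHS]mule_poweRB1//; apply: lee_wpmul2r; rewrite ?poweR_ge0.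
- apply: (@le_trans _ _ (c `^ p)); last by rewrite leeDr ?poweR_ge0.
  by rewrite -[leRHS]mule_poweRB1//; apply: lee_wpmul2l => //; exact: ge0_le_poweR.
Qed.

(** Write each power as its base times a power [p - 1], and enlarge the base of the latter to
    [x + y]. *)
Lemma poweR_superadditive p x y : (1 < p)%R -> 0 <= x -> 0 <= y ->
  x `^ p + y `^ p <= (x + y) `^ p.
Proof.
move=> p1 x0 y0; have q0 : (0 <= p - 1)%R by rewrite subr_ge0 ltW.
rewrite -(mule_poweRB1 p1 x0) -(mule_poweRB1 p1 y0).
rewrite -(mule_poweRB1 p1 (adde_ge0 x0 y0)) ge0_muleDl//.
by apply: leeD; apply: lee_wpmul2l => //; apply: ge0_le_poweR; rewrite ?leeDl ?leeDr.
Qed.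

Lemma poweR_sum_ge p (I : Type) (r : seq I) (P : pred I) (F : I -> \bar R) :
  (1 < p)%R -> (forall i, 0 <= F i) ->
  \sum_(i <- r | P i) F i `^ p <= (\sum_(i <- r | P i) F i) `^ p.
Proof.
move=> p1 F0; elim: r => [|i r IHr].
  by rewrite !big_nil poweR0r// gt_eqF// (lt_trans ltr01).
rewrite !big_cons; case: ifPn => // _.
apply: le_trans (leeD2l _ IHr) _.
by apply: poweR_superadditive => //; apply: sume_ge0.
Qed.
End extended_powers.

(** * The one-column moment bound *)

Section moments.
Context {d} {T : measurableType d} {R : realType}.
Variable mu : probability T R.
Local Open Scope ereal_scope.

Lemma measurable_fun_poweR (p : R) (f : T -> \bar R) :
  measurable_fun setT f -> measurable_fun setT (fun w => f w `^ p).
Proof. by move=> mf; exact: (measurableT_comp (measurable_poweR p)). Qed.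

(** Absorbing a term into the left-hand side requires a finite moment of the sum; finiteness of the
    individual moments suffices for it. *)
Lemma integral_poweR_sum_lty (p : R) (I : Type) (r : seq I) (f : I -> T -> \bar R) :
  (1 < p)%R -> (forall k, measurable_fun setT (f k)) -> (forall k w, 0 <= f k w) ->
  (forall k, \int[mu]_w (f k w `^ p) < +oo) ->
  \int[mu]_w ((\sum_(k <- r) f k w) `^ p) < +oo.
Proof.
move=> p1 mf f0 fp; have p0 : (0 < p)%R by rewrite (lt_trans ltr01).
elim: r => [|k r IHr].
  under eq_integral do rewrite big_nil poweR0r ?gt_eqF//.
  by rewrite integral0.
under eq_integral do rewrite big_cons.
have ms : measurable_fun setT (fun w => \sum_(j <- r) f j w) by exact: emeasurable_sum.
(* Both constants of the split coincide at [s = 1]. *)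
pose C := ((1 + 1) `^ p : R)%R.
have C0 : (0 <= C)%R by exact: powR_ge0.
apply: (@le_lt_trans _ _ (C%:E * \int[mu]_w (f k w `^ p) +
    C%:E * \int[mu]_w ((\sum_(j <- r) f j w) `^ p))); last first.
  by apply: lte_add_pinfty; apply: lte_mul_pinfty.
rewrite -!ge0_integralZl//; try exact: measurable_fun_poweR;
  try by move=> *; exact: poweR_ge0.
rewrite -ge0_integralD//; try (by move=> *; rewrite mule_ge0 ?lee_fin ?poweR_ge0);
  try exact/measurable_funeM/measurable_fun_poweR.
apply: ge0_le_integral => //.
- by move=> *; exact: poweR_ge0.
- exact/measurable_fun_poweR/emeasurable_funD.
- by apply: emeasurable_funD; exact/measurable_funeM/measurable_fun_poweR.
- move=> w _; have := @poweR_add_le _ p 1 (f k w) (\sum_(j <- r) f j w).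
  by rewrite invr1; apply=> //; exact: sume_ge0.
Qed.

(** Independence enters only through the last hypothesis, whose right-hand side already contains the
    full sum. The inner factors 2 come from doubling the estimate before one copy of the moment is
    absorbed. *)
Lemma moment_bound (K : finType) (f : K -> T -> \bar R) (p s : R) :
  (1 < p)%R -> (0 < s)%R ->
  (forall k, measurable_fun setT (f k)) -> (forall k w, 0 <= f k w) ->
  (forall k, \int[mu]_w (f k w * (\sum_(l | l != k) f l w) `^ (p - 1)) <=
     (\int[mu]_w f k w) * \int[mu]_w ((\sum_l f l w) `^ (p - 1))) ->
  \int[mu]_w ((\sum_k f k w) `^ p) <=
    ((2 * (1 + s) `^ (p - 1)) `^ p)%:E * (\sum_k \int[mu]_w f k w) `^ p +
    (2 * (1 + s^-1) `^ (p - 1))%:E * \sum_k \int[mu]_w (f k w `^ p).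
Proof.
move=> p1 s0 mf f0 indep.
have p0 : (0 < p)%R by rewrite (lt_trans ltr01).
pose S w := \sum_k f k w.
pose S' k w := \sum_(l | l != k) f l w.
have S0 w : 0 <= S w by exact: sume_ge0.
have S'0 k w : 0 <= S' k w by exact: sume_ge0.
have SE k w : S w = S' k w + f k w by rewrite /S (bigD1 k)//= addeC.
have mS : measurable_fun setT S by exact: emeasurable_sum.
have mS' k : measurable_fun setT (S' k).
  rewrite /S'; under eq_fun do rewrite big_mkcond.
  by apply: emeasurable_sum => l; case: (l != k).
have intf0 k : 0 <= \int[mu]_w f k w by apply: integral_ge0.
have intfp0 k : 0 <= \int[mu]_w (f k w `^ p).
  by apply: integral_ge0 => *; exact: poweR_ge0.
set m := \sum_k \int[mu]_w f k w.
set B := \sum_k \int[mu]_w (f k w `^ p).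
pose a := ((1 + s) `^ (p - 1))%R; pose b := ((1 + s^-1) `^ (p - 1))%R.
rewrite -/a -/b.
have a0 : (0 <= a)%R by exact: powR_ge0.
have b0 : (0 < b)%R by rewrite powR_gt0// addr_gt0// invr_gt0.
have b20 : 0 < (2 * b)%:E by rewrite lte_fin mulr_gt0.
have m0 : 0 <= m by exact: sume_ge0.
have B0 : 0 <= B by exact: sume_ge0.
(* If [B] is infinite, so is the bound; otherwise the moment is finite and can be cancelled. *)
have [->|] := eqVneq B +oo.
  by rewrite gt0_muley// addey ?leey//
    -ltNye (@lt_le_trans _ _ 0)// mule_ge0 ?poweR_ge0// lee_fin powR_ge0.
rewrite -ltey => Bfin.
have Mfin : \int[mu]_w (S w `^ p) < +oo.
  apply: integral_poweR_sum_lty => // k; apply: le_lt_trans Bfin.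
  by rewrite /B (bigD1 k)//= leeDl// sume_ge0.
set M := \int[mu]_w (S w `^ p); rewrite -/M in Mfin.
have M0 : 0 <= M by apply: integral_ge0 => *; exact: poweR_ge0.
have ME : M = \sum_k \int[mu]_w (f k w * S w `^ (p - 1)).
  rewrite -ge0_integral_sum//; last 2 first.
  - by move=> k; apply: emeasurable_funM => //; exact: measurable_fun_poweR.
  - by move=> k w _; rewrite mule_ge0 ?poweR_ge0.
  apply: eq_integral => w _; rewrite -ge0_sume_distrl//.
  exact/esym/(mule_poweRB1 p1 (S0 w)).
(* The pointwise split, integrated and summed over [k], with [indep] applied to its first term. *)
have M1 : M <= a%:E * (m * \int[mu]_w (S w `^ (p - 1))) + b%:E * B.
  rewrite ME /m /B ge0_sume_distrl// ge0_sume_distrr; last first.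
    by move=> k _; rewrite mule_ge0 ?integral_ge0// => *; exact: poweR_ge0.
  rewrite ge0_sume_distrr// -big_split/=; apply: lee_sum => k _.
  apply: le_trans (leeD2r _ (lee_wpmul2l _ (indep k))); last by rewrite lee_fin.
  have mk : measurable_fun setT (fun w => f k w * S' k w `^ (p - 1)).
    by apply: emeasurable_funM => //; exact: measurable_fun_poweR.
  rewrite -!ge0_integralZl//; try exact: measurable_fun_poweR;
    rewrite ?lee_fin ?(ltW b0)//; try (by move=> *; rewrite ?mule_ge0 ?poweR_ge0).
  rewrite -ge0_integralD//;
    try (by move=> *; rewrite ?mule_ge0 ?poweR_ge0 ?lee_fin ?(ltW b0));
    try (apply: measurable_funeM => //; exact: measurable_fun_poweR).
  apply: ge0_le_integral => //.
  - by move=> *; rewrite mule_ge0 ?poweR_ge0.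
  - by apply: emeasurable_funM => //; exact: measurable_fun_poweR.
  - by apply: emeasurable_funD; apply: measurable_funeM => //; exact: measurable_fun_poweR.
  - by move=> w _; rewrite (SE k); exact: mule_poweR_add_le.
have Sq0 : 0 <= \int[mu]_w (S w `^ (p - 1)).
  by apply: integral_ge0 => *; exact: poweR_ge0.
(* The doubling factor is put into [c], so that [c^p] is exactly the first term of the bound. *)
pose c := (2 * a)%:E * m.
have c0 : 0 <= c by rewrite mule_ge0// lee_fin mulr_ge0.
have -> : ((2 * a) `^ p)%:E * m `^ p = c `^ p.
  by rewrite -poweR_EFin -poweRM// lee_fin mulr_ge0.
have M2 : c * \int[mu]_w (S w `^ (p - 1)) <= M + c `^ p.
  have -> : c `^ p = \int[mu]_w (cst (c `^ p)) w.
    by rewrite integral_cst//= probability_setT mule1.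
  rewrite -ge0_integralZl//; [|exact: measurable_fun_poweR|by move=> *; exact: poweR_ge0].
  rewrite -ge0_integralD//;
    [|by move=> *; exact: poweR_ge0|exact: measurable_fun_poweR|by move=> *; exact: poweR_ge0].
  apply: ge0_le_integral => //.
  - by move=> *; rewrite mule_ge0 ?poweR_ge0.
  - by apply: measurable_funeM => //; exact: measurable_fun_poweR.
  - by apply: emeasurable_funD => //; exact: measurable_fun_poweR.
  - by move=> w _; exact: mule_poweR_le.
have Mf : M \is a fin_num by rewrite ge0_fin_numE.
(* Adding the finite [M] to both sides leaves [2 M <= M + c^p + 2 b B], which is twice [M1] followed
   by [M2]. *)
rewrite -(@leeD2lE _ M)//.
have M3 : M + M = 2%:E * M.
  by rewrite -[in RHS](fineK Mf) -EFinM -[in LHS](fineK Mf) -EFinD; congr EFin; lra.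
rewrite M3.
have M4 : 2%:E * M <= c * \int[mu]_w (S w `^ (p - 1)) + (2 * b)%:E * B.
  have -> : c * \int[mu]_w (S w `^ (p - 1)) = 2%:E * (a%:E * (m * \int[mu]_w (S w `^ (p - 1)))).
    by rewrite /c EFinM -!muleA.
  have -> : (2 * b)%:E * B = 2%:E * (b%:E * B) by rewrite EFinM -muleA.
  by rewrite -ge0_muleDr ?mule_ge0 ?lee_fin ?(ltW b0)// lee_wpmul2l// lee_fin.
by apply: (le_trans M4); rewrite addeA leeD2r.
Qed.

(** The graph of [t^p] lies above its tangent at [a]. For finite [x] this is Young's inequality for
    [x] and [a^(p - 1)], with exponents [p] and [p / (p - 1)]. *)
Lemma mule_poweR_tangent (p a : R) (x : \bar R) : (1 < p)%R -> (0 <= a)%R -> 0 <= x ->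
  (p * a `^ (p - 1))%:E * x <= x `^ p + ((p - 1) * a `^ p)%:E.
Proof.
move=> p1 a0; have p0 : (0 < p)%R by rewrite (lt_trans ltr01).
have q0 : (0 < p - 1)%R by rewrite subr_gt0.
case: x => [x|_|//]; last by rewrite poweRyr ?gt_eqF// addye// leey.
rewrite lee_fin => x0; rewrite poweR_EFin -EFinM -EFinD lee_fin.
have pq : (p^-1 + (p / (p - 1))^-1 = 1)%R.
  by rewrite invf_div -[X in (X + _)%R]mul1r -mulrDl addrC subrK divff ?gt_eqF.
have := conjugate_powR x0 (powR_ge0 a (p - 1)) p0 (divr_gt0 p0 q0) pq.
have pE : ((p - 1) * (p / (p - 1)) = p)%R by rewrite mulrC divfK ?gt_eqF.
rewrite -powRrM pE.
move=> /(ler_wpM2l (ltW p0)).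
rewrite [X in (_ <= X)%R -> _](_ : _ = x `^ p + (p - 1) * a `^ p)%R; last first.
  by field; rewrite !gt_eqF.
by rewrite mulrCA mulrC -mulrA [(a `^ _ * _)%R]mulrC mulrA.
Qed.

(** Integrate the tangent inequality at the mean of [f]. If the mean is infinite, the tangent at 1
    forces the right-hand side to be infinite too. *)
Lemma jensen_poweR (p : R) (f : T -> \bar R) : (1 < p)%R ->
  measurable_fun setT f -> (forall w, 0 <= f w) ->
  (\int[mu]_w f w) `^ p <= \int[mu]_w (f w `^ p).
Proof.
move=> p1 mf f0; have p0 : (0 < p)%R by rewrite (lt_trans ltr01).
have tangent a : (0 <= a)%R -> (p * a `^ (p - 1))%:E * \int[mu]_w f w <=
    \int[mu]_w (f w `^ p) + ((p - 1) * a `^ p)%:E.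
  move=> a0.
  have -> : ((p - 1) * a `^ p)%:E = \int[mu]_w (cst ((p - 1) * a `^ p)%:E) w.
    by rewrite integral_cst//= probability_setT mule1.
  have c0 : (0 <= (p - 1) * a `^ p)%R by rewrite mulr_ge0 ?powR_ge0 ?subr_ge0 ?ltW.
  have d0 : (0 <= p * a `^ (p - 1))%R by rewrite mulr_ge0 ?powR_ge0 ?ltW.
  rewrite -ge0_integralZl// -ge0_integralD//;
    [|by move=> *; exact: poweR_ge0|exact: measurable_fun_poweR].
  apply: ge0_le_integral => //.
  - by move=> *; rewrite mule_ge0.
  - exact: measurable_funeM.
  - by apply: emeasurable_funD => //; exact: measurable_fun_poweR.
  - by move=> w _; exact: mule_poweR_tangent.
have : 0 <= \int[mu]_w f w by exact: integral_ge0.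
move: tangent; case: (\int[mu]_w f w) => [a|/(_ 1%R ler01)|//].
- move=> tangent; rewrite lee_fin => a0; move/(_ _ a0): tangent.
  rewrite -EFinM -mulrA [(_ `^ _ * _)%R]mulrC mulr_powRB1// poweR_EFin.
  have -> : (p * a `^ p = a `^ p + (p - 1) * a `^ p)%R by ring.
  by rewrite EFinD leeD2rE.
- rewrite powR1 mulr1 gt0_muley ?lte_fin// leye_eq.
  case: (\int[mu]_w _) => [r| |] /eqP// _ _; exact: leey.
Qed.
End moments.

(** * Decoupling of independent variables *)

Lemma bigcap_finType_measurable d (T : measurableType d) (I : finType)
    (F : I -> set T) (P : set I) :
  (forall i, measurable (F i)) -> measurable (\bigcap_(i in P) F i).
Proof.
by move=> mF; apply: fin_bigcap_measurable => //; exact: finite_finset.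
Qed.

Section tuple_measure.
Context d (S : measurableType d) (R : realType) (N : nat).
Implicit Types A : 'I_N -> set S.

Definition tuple_box A : set (N.-tuple S) := [set u | forall i, A i (tnth u i)].

Lemma tuple_boxE A : tuple_box A = \bigcap_(i in setT) ((fun u => tnth u i) @^-1` A i).
Proof. by apply/seteqP; split=> u /= h i; [move=> _|]; exact: h. Qed.

Definition tuple_boxes : set (set (N.-tuple S)) :=
  [set B | exists2 A, (forall i, measurable (A i)) & B = tuple_box A].

(** A coordinate preimage is a box with all other sides full, and a box is a finite intersection of
    coordinate preimages. *)
Lemma measurable_tuple_boxes :
  (@measurable _ (N.-tuple S)) = <<s tuple_boxes >>.
Proof.
apply/seteqP; split.
- apply: smallest_sub; first exact: smallest_sigma_algebra.
  rewrite -bigcup_seq; apply: bigcup_sub => i _ _ [B mB <-].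
  apply: sub_sigma_algebra; rewrite setTI.
  exists (fun j => if j == i then B else setT).
    by move=> j; case: ifP.
  apply/seteqP; split=> u /= h.
    by move=> j; case: ifPn => // /eqP ->.
  by have := h i; rewrite eqxx.
- apply: smallest_sub; first exact: sigma_algebra_measurable.
  move=> _ [A mA ->]; rewrite tuple_boxE; apply: bigcap_finType_measurable => i.
  by rewrite -[X in measurable X]setTI; exact: measurable_tnth.
Qed.

(** The boxes form a generating family stable under intersection and containing the full space,
    which has finite mass. *)
Lemma tuple_measure_unique (m1 m2 : {measure set (N.-tuple S) -> \bar R}) :
  (m1 setT < +oo)%E ->
  (forall A, (forall i, measurable (A i)) -> m1 (tuple_box A) = m2 (tuple_box A)) ->
  forall B, measurable B -> m1 B = m2 B.
Proof.
move=> fin m12; have boxT : setT = tuple_box (fun=> setT) by apply/seteqP.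
apply: (measure_unique tuple_boxes (fun=> setT)) => //.
- exact: measurable_tuple_boxes.
- move=> _ _ [A mA ->] [B mB ->]; exists (fun i => A i `&` B i).
    by move=> i; exact: measurableI.
  apply/seteqP; split=> u /=; first by move=> [h1 h2] i; split.
  by move=> h; split=> i; case: (h i).
- by move=> _; exists (fun=> setT).
- by apply/seteqP; split=> // u _; exists 0%N.
- by move=> _ [A mA ->]; exact: m12.
Qed.

End tuple_measure.

Section decoupling.
Context d (Omega : measurableType d) (R : realType) (P : probability Omega R).
Context d' (S : measurableType d') (T : finType) (Z : T -> {RV P >-> S}).

(* Stands for measurability with respect to the product sigma-algebra on [T -> S]. *)
Definition measurable_functional (G : (T -> S) -> \bar R) :=
  forall d1 (U : measurableType d1) (Y : T -> U -> S),
    (forall t, measurable_fun setT (Y t)) ->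
    measurable_fun setT (fun u => G (fun t => Y t u)).

Let N := #|T|.
(** Families indexed by [T] are coded as tuples along the enumeration of [T], so that their laws are
    measures on a product sigma-algebra. *)
Let tup (z : T -> S) : N.-tuple S := [tuple z (enum_val i) | i < N].
Let untup (u : N.-tuple S) (t : T) : S := tnth u (enum_rank t).

Let tupK z : untup (tup z) = z.
Proof. by apply/funext => t; rewrite /untup tnth_mktuple enum_rankK. Qed.

(** Replacing the variables outside [A] by an independent copy, carried by the second factor of
    [P \x P], does not change the joint law. *)
Lemma decoupling (A : {set T}) (G : (T -> S) -> \bar R) :
  mutually_independent Z -> measurable_functional G -> (forall z, 0 <= G z)%E ->
  (\int[P]_w G (fun t => Z t w) =
   \int[P]_w \int[P]_w' G (fun t => if t \in A then Z t w else Z t w'))%E.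
Proof.
move=> indep mG G0.
pose phi w := tup (fun t => Z t w).
pose psi (v : Omega * Omega) := tup (fun t => if t \in A then Z t v.1 else Z t v.2).
have mphi : measurable_fun setT phi.
  apply/measurable_fun_tnthP => i.
  have -> : @tnth N S ^~ i \o phi = Z (enum_val i).
    by apply/funext => w /=; rewrite tnth_mktuple.
  exact: measurable_funPT.
have mpsi : measurable_fun setT psi.
  apply/measurable_fun_tnthP => i.
  pose t := enum_val i.
  have -> : @tnth N S ^~ i \o psi = if t \in A then Z t \o fst else Z t \o snd.
    by apply/funext => w /=; rewrite tnth_mktuple -/t; case: ifP.
  by case: ifP => _; apply: measurableT_comp => //; exact: measurable_funPT.
have mG' : measurable_fun setT (G \o untup).
  by apply: (mG _ _ (fun t u => tnth u (enum_rank t))) => t; exact: measurable_tnth.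
pose phi' : {mfun Omega >-> N.-tuple S} := HB.pack phi (isMeasurableFun.Build _ _ _ _ _ mphi).
pose psi' : {mfun (Omega * Omega)%type >-> N.-tuple S} :=
  HB.pack psi (isMeasurableFun.Build _ _ _ _ _ mpsi).
(* Both sides become integrals of the same function, against two image laws that need only be
   compared on boxes. *)
transitivity (\int[pushforward P phi']_u (G (untup u)))%E.
  rewrite (ge0_integral_pushforward mphi)//.
  by apply: eq_integral => w _ /=; rewrite tupK.
transitivity (\int[pushforward (P \x P)%E psi']_u (G (untup u)))%E; last first.
  rewrite (ge0_integral_pushforward mpsi)//= fubini_tonelli1//=.
  - by apply: eq_integral => w _; apply: eq_integral => w' _; rewrite /= tupK.
  - exact: (measurableT_comp mG' mpsi).
apply: eq_measure_integral => B mB _.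
apply: (@tuple_measure_unique _ S R N (pushforward P phi') (pushforward (P \x P)%E psi')) => //.
  by change (P setT < +oo)%E; rewrite probability_setT ltry.
move=> {mB}B mB /=; rewrite /pushforward.
pose C t := B (enum_rank t).
have mC t : measurable (C t) by exact: mB.
have mcap (K : {set T}) : measurable (\bigcap_(t in [set` K]) (Z t @^-1` C t)).
  by apply: bigcap_finType_measurable => t; exact: measurable_funPTI.
have -> : phi @^-1` tuple_box B = \bigcap_(t in [set` [set: T]%SET]) (Z t @^-1` C t).
  apply/seteqP; split=> w /= h.
    by move=> t _; have := h (enum_rank t); rewrite tnth_mktuple enum_rankK.
  move=> i; rewrite tnth_mktuple; have := h (enum_val i).
  by rewrite /C /= enum_valK; apply; rewrite inE.
(* The preimage of a box is a rectangle: the indices in [A] constrain the first factor, the others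
   the second. *)
have -> : psi @^-1` tuple_box B =
    (\bigcap_(t in [set` A]) (Z t @^-1` C t)) `*` (\bigcap_(t in [set` ~: A]) (Z t @^-1` C t)).
  apply/seteqP; split=> -[w w'] /= h.
    split=> t /=; rewrite ?inE => tA; have := h (enum_rank t);
      by rewrite tnth_mktuple enum_rankK ?tA ?(negbTE tA).
  move=> i; rewrite tnth_mktuple; case: h => h1 h2.
  case: ifPn => tA.
    by have := h1 (enum_val i); rewrite /C /= enum_valK; exact.
  by have := h2 (enum_val i); rewrite /C /= enum_valK inE; exact.
rewrite product_measure1E// indep// (bigID (mem A))/=.
congr (_ * _)%E; apply: (etrans _ (esym (indep _ C mC))).
  by apply: eq_bigl => t; rewrite !inE.
by apply: eq_bigl => t; rewrite !inE.
Qed.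
End decoupling.

(** * Partial expectations *)

Section partial_expectations.
Context d (Omega : measurableType d) (R : realType) (P : probability Omega R).
Context d' (S : measurableType d') (n m : nat).
Variable X : 'I_n -> 'I_m -> {RV P >-> S}.
Implicit Types (J D : {set 'I_m}) (F G : ('I_n -> 'I_m -> S) -> \bar R).
Implicit Types (x y z : 'I_n -> 'I_m -> S).
Local Open Scope ereal_scope.
Local Notation pe := (partial_expectation X).

(** Arrays are read as families indexed by pairs, the form in which independence is stated. *)
Definition measurable_array_functional F :=
  measurable_functional (fun z : 'I_n * 'I_m -> S => F (fun k j => z (k, j))).

Lemma measurable_array_functionalP F d1 (U : measurableType d1)
    (Y : 'I_n -> 'I_m -> U -> S) :
  measurable_array_functional F -> (forall k j, measurable_fun setT (Y k j)) ->
  measurable_fun setT (fun u => F (fun k j => Y k j u)).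
Proof. by move=> mF mY; exact: (mF _ _ (fun t => Y t.1 t.2)). Qed.

Lemma measurable_mixed F J x : measurable_array_functional F ->
  measurable_fun setT (fun w => F (fun k j => if j \in J then X k j w else x k j)).
Proof.
move=> mF; apply: (measurable_array_functionalP
  (Y := fun k j w => if j \in J then X k j w else x k j)) => // k j.
by case: (j \in J).
Qed.

Lemma partial_expectation_ge0 J F x : (forall z, 0 <= F z) -> 0 <= pe J F x.
Proof. by move=> F0; exact: integral_ge0. Qed.

(** By Tonelli, integrating out the second variable of a jointly measurable nonnegative function on
    [U * Omega] leaves a measurable function. *)
Lemma measurable_partial_expectation J F : (forall z, 0 <= F z) ->
  measurable_array_functional F -> measurable_array_functional (pe J F).
Proof.
move=> F0 mF d1 U Y mY.
pose Y' k j (v : U * Omega) := if j \in J then X k j v.2 else Y (k, j) v.1.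
have mY' k j : measurable_fun setT (Y' k j).
  by rewrite /Y'; case: (j \in J); exact: measurableT_comp.
have /(measurable_fun_fubini_tonelli_F (m2 := P)) := measurable_array_functionalP mF mY'.
by apply => v.
Qed.

Lemma le_partial_expectation J F G x : (forall z, 0 <= F z) ->
  measurable_array_functional F -> measurable_array_functional G ->
  (forall z, F z <= G z) -> pe J F x <= pe J G x.
Proof.
move=> F0 mF mG FG; apply: ge0_le_integral => //; exact: measurable_mixed.
Qed.

Lemma eq_partial_expectation J F G x : (forall z, F z = G z) -> pe J F x = pe J G x.
Proof. by move=> FG; apply: eq_integral => w _; exact: FG. Qed.

Lemma partial_expectation_set0 F x : pe finset.set0 F x = F x.
Proof.
rewrite /partial_expectation; have -> : (fun w : Omega => F (fun k j =>
    if j \in finset.set0 then X k j w else x k j)) = cst (F x).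
  by apply/funext => w /=; congr F; apply/funext => k; apply/funext => j; rewrite inE.
by rewrite integral_cst//= probability_setT mule1.
Qed.

Lemma partial_expectation_setT F x : pe finset.setT F x = \int[P]_w F (fun k j => X k j w).
Proof.
apply: eq_integral => w _; congr F.
by apply/funext => k; apply/funext => j; rewrite inE.
Qed.

Lemma partial_expectation_sum (I : Type) (r : seq I) (Q : pred I)
    (F : I -> ('I_n -> 'I_m -> S) -> \bar R) J x :
  (forall i z, 0 <= F i z) -> (forall i, measurable_array_functional (F i)) ->
  pe J (fun z => \sum_(i <- r | Q i) F i z) x = \sum_(i <- r | Q i) pe J (F i) x.
Proof.
move=> F0 mF; rewrite /partial_expectation.
under eq_integral do rewrite -big_filter.
rewrite ge0_integral_sum//; first by rewrite big_filter.
by move=> i; exact: measurable_mixed.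
Qed.

Lemma partial_expectationD F G J x : (forall z, 0 <= F z) -> (forall z, 0 <= G z) ->
  measurable_array_functional F -> measurable_array_functional G ->
  pe J (fun z => F z + G z) x = pe J F x + pe J G x.
Proof.
by move=> F0 G0 mF mG; rewrite [LHS]ge0_integralD//; exact: measurable_mixed.
Qed.

Lemma partial_expectationZ (c : R) F J x : (0 <= c)%R -> (forall z, 0 <= F z) ->
  measurable_array_functional F ->
  pe J (fun z => c%:E * F z) x = c%:E * pe J F x.
Proof.
by move=> c0 F0 mF; rewrite [LHS]ge0_integralZl//; exact: measurable_mixed.
Qed.

Lemma jensen_partial_expectation (p : R) F J x : (1 < p)%R -> (forall z, 0 <= F z) ->
  measurable_array_functional F ->
  pe J F x `^ p <= pe J (fun z => F z `^ p) x.
Proof. by move=> p1 F0 mF; apply: jensen_poweR => //; exact: measurable_mixed. Qed.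

Lemma measurable_array_functional_sum (I : Type) (r : seq I) (Q : pred I)
    (F : I -> ('I_n -> 'I_m -> S) -> \bar R) :
  (forall i, measurable_array_functional (F i)) ->
  measurable_array_functional (fun z => \sum_(i <- r | Q i) F i z).
Proof.
move=> mF d1 U Y mY; under eq_fun do rewrite -big_filter.
by apply: emeasurable_sum => i; exact: mF.
Qed.

Lemma measurable_array_functional_poweR (p : R) F :
  measurable_array_functional F -> measurable_array_functional (fun z => F z `^ p).
Proof. by move=> mF d1 U Y mY; apply: measurable_fun_poweR; exact: mF. Qed.

Lemma measurable_array_functionalD F G :
  measurable_array_functional F -> measurable_array_functional G ->
  measurable_array_functional (fun z => F z + G z).
Proof.
by move=> mF mG d1 U Y mY; apply: emeasurable_funD; [exact: mF|exact: mG].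
Qed.

Lemma measurable_array_functionalM F G :
  measurable_array_functional F -> measurable_array_functional G ->
  measurable_array_functional (fun z => F z * G z).
Proof.
by move=> mF mG d1 U Y mY; apply: emeasurable_funM; [exact: mF|exact: mG].
Qed.

Hypothesis indep : mutually_independent (fun kj : 'I_n * 'I_m => X kj.1 kj.2).

Lemma array_decoupling (A : {set 'I_n * 'I_m}) F :
  (forall z, 0 <= F z) -> measurable_array_functional F ->
  \int[P]_w F (fun k j => X k j w) =
  \int[P]_w \int[P]_w' F (fun k j => if (k, j) \in A then X k j w else X k j w').
Proof.
by move=> F0 mF; rewrite (decoupling A indep mF).
Qed.

Lemma measurable_array_functional_mixed J F x : measurable_array_functional F ->
  measurable_array_functional (fun z => F (fun k j => if j \in J then z k j else x k j)).
Proof.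
move=> mF d1 U Y mY.
apply: (measurable_array_functionalP (Y := fun k j u =>
  if j \in J then Y (k, j) u else x k j)) => // k j.
by case: (j \in J).
Qed.

(** The nested integrals sample the columns in [J] and those in [D] separately, whereas the single
    one samples them jointly; decoupling along the columns in [J] identifies the two. *)
Lemma partial_expectation_tower J D F x : [disjoint J & D]%B ->
  (forall z, 0 <= F z) -> measurable_array_functional F ->
  pe J (pe D F) x = pe (J :|: D)%SET F x.
Proof.
move=> JD F0 mF; rewrite [RHS](array_decoupling [set kj | kj.2 \in J]%SET
  (F := fun z => F (fun k j => if j \in (J :|: D)%SET then z k j else x k j)))//; last first.
  exact: measurable_array_functional_mixed.
apply: eq_integral => w _; apply: eq_integral => w' _; congr F.
apply/funext => k; apply/funext => j; rewrite !inE/=.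
case: ifPn => [jD|]; last by rewrite orbF; case: (j \in J).
by rewrite orbT (disjointFl JD jD).
Qed.

(** With the other columns fixed, the last hypothesis makes [g k] a function of the single entry
    [(k, j)], so that the [g k] are independent and the moment bound applies. *)
Lemma partial_expectation_column_bound j (g : 'I_n -> ('I_n -> 'I_m -> S) -> \bar R)
    (p s : R) x : (1 < p)%R -> (0 < s)%R ->
  (forall k z, 0 <= g k z) -> (forall k, measurable_array_functional (g k)) ->
  (forall k y z, y k j = z k j ->
    (forall k' j', j' != j -> y k' j' = z k' j') -> g k y = g k z) ->
  pe [set j]%SET (fun z => (\sum_k g k z) `^ p) x <=
    ((2 * (1 + s) `^ (p - 1)) `^ p)%:E * (\sum_k pe [set j]%SET (g k) x) `^ p +
    (2 * (1 + s^-1) `^ (p - 1))%:E * \sum_k pe [set j]%SET (fun z => g k z `^ p) x.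
Proof.
move=> p1 s0 g0 mg gdep; apply: moment_bound => //.
  by move=> k; exact: measurable_mixed.
move=> k; pose mix z k' j' := if j' \in [set j]%SET then z k' j' else x k' j'.
(* The entry [(k, j)] is sampled separately from all the others. *)
have E := array_decoupling [set (k, j)]%SET
  (F := fun z => g k (mix z) * (\sum_(l | l != k) g l (mix z)) `^ (p - 1)).
rewrite [leLHS]E; last 2 first.
- by move=> z; rewrite mule_ge0// poweR_ge0.
- apply: measurable_array_functionalM; first exact: measurable_array_functional_mixed.
  apply: measurable_array_functional_poweR; apply: measurable_array_functional_sum => i.
  exact: measurable_array_functional_mixed.
pose Xm w k' j' := mix (fun k j => X k j w) k' j'.
have -> : \int[P]_w \int[P]_w' (g k (mix (fun k0 j0 =>
     if (k0, j0) \in [set (k, j)]%SET then X k0 j0 w else X k0 j0 w')) *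
   (\sum_(l | l != k) g l (mix (fun k0 j0 =>
     if (k0, j0) \in [set (k, j)]%SET then X k0 j0 w else X k0 j0 w'))) `^ (p - 1)) =
   \int[P]_w \int[P]_w' (g k (Xm w) * (\sum_(l | l != k) g l (Xm w')) `^ (p - 1)).
  (* In column [j], [g k] reads only row [k], taken at [w], and the other summands read only rows
     [l != k], taken at [w']. *)
  apply: eq_integral => w _; apply: eq_integral => w' _; congr (_ * _ `^ _).
    apply: gdep; first by rewrite /Xm /mix !inE !eqxx.
    by move=> k' j' jj'; rewrite /Xm /mix inE (negbTE jj').
  apply: eq_bigr => l lk; apply: gdep.
    by rewrite /Xm /mix !inE !eqxx xpair_eqE (negbTE lk).
  by move=> k' j' jj'; rewrite /Xm /mix inE (negbTE jj').
have mS : measurable_fun setT (fun w => (\sum_(l | l != k) g l (Xm w)) `^ (p - 1)).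
  apply: (measurable_mixed (F := fun z => (\sum_(l | l != k) g l z) `^ (p - 1))).
  apply: measurable_array_functional_poweR; exact: measurable_array_functional_sum.
have mS' : measurable_fun setT (fun w => (\sum_l g l (Xm w)) `^ (p - 1)).
  apply: (measurable_mixed (F := fun z => (\sum_l g l z) `^ (p - 1))).
  apply: measurable_array_functional_poweR; exact: measurable_array_functional_sum.
rewrite (eq_integral (fun w => g k (Xm w) *
    \int[P]_w' ((\sum_(l | l != k) g l (Xm w')) `^ (p - 1)))); last first.
  by move=> w _; rewrite ge0_integralZl// => *; exact: poweR_ge0.
rewrite ge0_integralZr//; [|exact: measurable_mixed|by apply: integral_ge0 => *; exact: poweR_ge0].
apply: lee_wpmul2l; first exact: integral_ge0.
(* Restoring the missing nonnegative summand can only increase the power. *)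
apply: ge0_le_integral => //; first by move=> *; exact: poweR_ge0.
move=> w _; apply: ge0_le_poweR; rewrite ?subr_ge0 ?(ltW p1)//; first exact: sume_ge0.
by rewrite [leRHS](bigD1 k)//= leeDr.
Qed.

End partial_expectations.

(** * Partial multi-indices *)

Lemma big_option_fin (R : Type) (idx : R) (op : Monoid.com_law idx) (I : finType)
    (F : option I -> R) :
  \big[op/idx]_(o : option I) F o = op (F None) (\big[op/idx]_(k : I) F (Some k)).
Proof.
rewrite (bigD1 None)//=; congr (op _ _).
rewrite (reindex_omap Some id); last by case.
by apply: eq_bigl => k; rewrite eqxx.
Qed.

Section partial_index.
Context (n m : nat).
Implicit Types (b : {ffun 'I_m -> option 'I_n}) (i : m.-tuple 'I_n) (J D : {set 'I_m}).

(* [b] encodes a pair [(J, i_J)]: [J] is the set of places where [b] is defined. *)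
Definition supp b : {set 'I_m} := [set j | b j != None]%SET.

Definition matches b i := [forall j, (b j == None) || (b j == Some (tnth i j))].

Definition update b j o : {ffun 'I_m -> option 'I_n} :=
  [ffun j' => if j' == j then o else b j'].

Lemma update_None b j : j \notin supp b -> update b j None = b.
Proof.
rewrite inE negbK => /eqP bj; apply/ffunP => j'; rewrite ffunE.
by case: (j' =P j) => // ->.
Qed.

Lemma supp_update_Some b j k : supp (update b j (Some k)) = (j |: supp b)%SET.
Proof. by apply/setP => j'; rewrite !inE ffunE; case: (j' == j). Qed.

Lemma matches_update b j k i : j \notin supp b ->
  matches (update b j (Some k)) i = matches b i && (tnth i j == k).
Proof.
rewrite inE negbK => /eqP bj; apply/forallP/andP.
- move=> h; split.
    apply/forallP => j'; have := h j'; rewrite ffunE.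
    by case: (j' =P j) => // -> _; rewrite bj.
  by have := h j; rewrite ffunE eqxx/= => /eqP[->].
- move=> [/forallP h /eqP <-] j'; rewrite ffunE.
  by case: (j' =P j) => [->|_]//; rewrite eqxx.
Qed.

(** A partial multi-index on [D] with [j] added is a partial multi-index on [D] together with a
    value, possibly undefined, at [j]. *)
Lemma sum_update (V : nmodType) (F : {ffun 'I_m -> option 'I_n} -> V) D j : j \notin D ->
  \sum_(b | supp b \subset (j |: D)%SET) F b =
  \sum_(b | supp b \subset D) \sum_o F (update b j o).
Proof.
move=> jD; rewrite pair_big_dep/=.
rewrite (reindex_onto (fun bo => update bo.1 j bo.2) (fun b => (update b j None, b j))).
  apply: eq_bigl => -[b o] /=; rewrite [RHS]andbT; apply/esym; apply/idP/andP.
  - move=> bD; have jb : j \notin supp b by apply: contra jD => /(fintype.subsetP bD).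
    split.
      apply/fintype.subsetP => j'; rewrite !inE ffunE; case: (j' =P j) => //= _ bj'.
      by apply: (fintype.subsetP bD); rewrite inE.
    rewrite xpair_eqE ffunE eqxx eqxx andbT; apply/eqP.
    by rewrite -[RHS](update_None jb); apply/ffunP => j'; rewrite !ffunE; case: (j' =P j).
  - move=> [sD]; rewrite xpair_eqE => /andP[/eqP bE _].
    apply/fintype.subsetP => j' j'b; have j'j : j' != j.
      by move: j'b; rewrite -bE inE ffunE; case: (j' == j).
    have /(fintype.subsetP sD) : j' \in supp (update b j o).
      by move: j'b; rewrite !inE ffunE (negbTE j'j).
    by rewrite !inE (negbTE j'j).
by move=> b _; apply/ffunP => j'; rewrite !ffunE; case: (j' =P j) => // ->.
Qed.

Section extension.
Variable J : {set 'I_m}.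
Implicit Types a : {ffun {j : 'I_m | j \in J} -> 'I_n}.

(** Identifies the summation index of a bracket with a partial multi-index of support [J]. *)
Definition extend a : {ffun 'I_m -> option 'I_n} := [ffun j => omap a (insub j)].

Lemma extend_in a (u : {j : 'I_m | j \in J}) : extend a (val u) = Some (a u).
Proof. by rewrite ffunE valK. Qed.

Lemma extend_out a j : j \notin J -> extend a j = None.
Proof. by move=> jJ; rewrite ffunE insubN. Qed.

Lemma supp_extend a : supp (extend a) = J.
Proof.
apply/setP => j; rewrite inE; case: (boolP (j \in J)) => jJ.
  by rewrite (extend_in a (Sub j jJ)).
by rewrite extend_out.
Qed.

Lemma matches_extend a i : matches (extend a) i = (del_coords J i == a).
Proof.
apply/forallP/eqP => [h|<- j].
  apply/ffunP => u; rewrite ffunE; have := h (val u).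
  by rewrite extend_in/= => /eqP[->].
case: (boolP (j \in J)) => jJ; last by rewrite extend_out.
by rewrite (extend_in _ (Sub j jJ)) ffunE/= eqxx.
Qed.

Lemma extend_inj : injective extend.
Proof.
move=> a a' aa'; apply/ffunP => u; apply: Some_inj.
by rewrite -!extend_in aa'.
Qed.

Lemma extend_onto b : supp b = J -> exists a, b = extend a.
Proof.
move=> bJ.
have /fin_all_exists[f bf] (u : {j : 'I_m | j \in J}) : exists k, b (val u) = Some k.
  have : val u \in supp b by rewrite bJ; exact: (valP u).
  rewrite inE; by case: (b (val u)) => // k _; exists k.
exists [ffun u => f u]; apply/ffunP => j; case: (boolP (j \in J)) => jJ.
  by rewrite (extend_in _ (Sub j jJ)) ffunE -bf.
rewrite extend_out//; apply/eqP; move: jJ; apply: contraNT => bj.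
by rewrite -bJ inE.
Qed.

Lemma sum_supp (V : nmodType) (F : {ffun 'I_m -> option 'I_n} -> V) :
  \sum_(b | supp b == J) F b = \sum_a F (extend a).
Proof.
rewrite -(big_imset F (h := extend) (A := predT)); last by move=> ? ? _ _; exact: extend_inj.
apply: eq_bigl => b; apply/eqP/imsetP => [/extend_onto[a ->]|[a _ ->]].
  by exists a.
exact: supp_extend.
Qed.

End extension.
End partial_index.

(** * Induction on the columns *)

Section column_induction.
Context d (Omega : measurableType d) (R : realType) (P : probability Omega R).
Context d' (S : measurableType d') (n m : nat).
Variable X : 'I_n -> 'I_m -> {RV P >-> S}.
Hypothesis indep : mutually_independent (fun kj : 'I_n * 'I_m => X kj.1 kj.2).
Variable H : m.-tuple 'I_n -> ('I_n -> 'I_m -> S) -> \bar R.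
Hypothesis H0 : forall i z, (0 <= H i z)%E.
Hypothesis mH : forall i, measurable_array_functional (H i).
Hypothesis H_local : forall i y z,
  (forall j, y (tnth i j) j = z (tnth i j) j) -> H i y = H i z.
Variables p s : R.
Hypothesis p1 : 1 < p.
Hypothesis s0 : 0 < s.
Local Open Scope ereal_scope.
Local Notation pe := (partial_expectation X).
Implicit Types (J D : {set 'I_m}) (b : {ffun 'I_m -> option 'I_n}).

(* The state reached once the columns in [D] have been treated: those in [supp b]
   were pulled out of the power, the others of [D] were averaged inside it.
   [D = set0] gives the moment, [D = setT] the summands of the brackets. *)
Definition processed D b x : \bar R :=
  pe (supp b :|: ~: D)%SET (fun y =>
    (\sum_(i : m.-tuple 'I_n | matches b i) pe (D :\: supp b)%SET (H i) y) `^ p) x.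

Let C1 : R := ((2 * (1 + s) `^ (p - 1)) `^ p)%R.
Let C2 : R := (2 * (1 + s^-1) `^ (p - 1))%R.

Let C1_ge0 : (0 <= C1)%R. Proof. exact: powR_ge0. Qed.
Let C2_ge0 : (0 <= C2)%R. Proof. by rewrite mulr_ge0 ?powR_ge0. Qed.

Lemma partial_expectation_local D i y z :
  (forall j, y (tnth i j) j = z (tnth i j) j) -> pe D (H i) y = pe D (H i) z.
Proof.
move=> yz; apply: eq_integral => w _; apply: H_local => j.
by case: (j \in D).
Qed.

Let mpH D i : measurable_array_functional (pe D (H i)).
Proof. exact: measurable_partial_expectation. Qed.

Let pH0 D i z : 0 <= pe D (H i) z.
Proof. exact: partial_expectation_ge0. Qed.

Lemma processed_ge0 D b x : 0 <= processed D b x.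
Proof. by apply: partial_expectation_ge0 => z; exact: poweR_ge0. Qed.

(** The sum inside the power is grouped by the value [k] of [i_j], and the one-column bound is
    applied with the other columns fixed. Its first term averages column [j] inside the power; its
    second fixes [i_j = k] and pulls the column out. *)
Lemma processed_step D b j x : j \notin D -> supp b \subset D ->
  processed D b x <= C1%:E * processed (j |: D)%SET b x +
    C2%:E * \sum_(k < n) processed (j |: D)%SET (update b j (Some k)) x.
Proof.
move=> jD bD; have jb : j \notin supp b by apply: contra jD => /(fintype.subsetP bD).
pose g k z := \sum_(i : m.-tuple 'I_n | matches b i && (tnth i j == k))
  pe (D :\: supp b)%SET (H i) z.
have g0 k z : 0 <= g k z by exact: sume_ge0.
have mg k : measurable_array_functional (g k) by exact: measurable_array_functional_sum.
have gp0 k z : 0 <= g k z `^ p by exact: poweR_ge0.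
have mgp k : measurable_array_functional (fun z => g k z `^ p).
  exact: measurable_array_functional_poweR.
(* The columns other than [j] that are integrated outside the power. *)
pose A := (supp b :|: ~: (j |: D))%SET.
have msum (F : 'I_n -> ('I_n -> 'I_m -> S) -> \bar R) :
    (forall k, measurable_array_functional (F k)) ->
    measurable_array_functional (fun z => \sum_(k < n) F k z).
  by move=> mF; exact: measurable_array_functional_sum.
have AE : (supp b :|: ~: D = A :|: [set j])%SET.
  apply/setP => j'; rewrite !inE; case: (j' =P j) => [->|_] /=; last by rewrite orbF.
  by rewrite (negbTE jD) !orbT.
have jA : [disjoint A & [set j]%SET]%B.
  rewrite disjoint_sym disjoints1 !inE eqxx/= orbF; by move: jb; rewrite inE.
have -> : processed D b x = pe A (pe [set j]%SET (fun z => (\sum_k g k z) `^ p)) x.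
  rewrite partial_expectation_tower//; first last.
  - exact/measurable_array_functional_poweR/msum.
  - by move=> z; exact: poweR_ge0.
  rewrite /processed AE; apply: eq_partial_expectation => z; congr (_ `^ p).
  by rewrite (partition_big (fun i : m.-tuple 'I_n => tnth i j) predT).
(* Column [j] joins the inner expectation by linearity and the tower property. *)
have -> : processed (j |: D)%SET b x =
    pe A (fun z => (\sum_k pe [set j]%SET (g k) z) `^ p) x.
  apply: eq_partial_expectation => z; congr (_ `^ p).
  rewrite (partition_big (fun i : m.-tuple 'I_n => tnth i j) predT)//=.
  apply: eq_bigr => k _; rewrite partial_expectation_sum//; apply: eq_bigr => i _.
  rewrite partial_expectation_tower//; first last.
    by rewrite disjoints1 !inE (negbTE jD) andbF.
  suff -> : ((j |: D) :\: supp b = [set j] :|: (D :\: supp b))%SET by [].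
  apply/setP => j'; rewrite !inE.
  case: (j' =P j) => [->|_]//=; by move: jb; rewrite inE => ->.
(* Column [j] joins the outer expectation; prescribing [i_j = k] selects exactly the multi-indices
   of [g k]. *)
have -> : \sum_(k < n) processed (j |: D)%SET (update b j (Some k)) x =
    pe A (fun z => \sum_(k < n) pe [set j]%SET (fun z => g k z `^ p) z) x.
  rewrite partial_expectation_sum//; last first.
  - by move=> k; exact: measurable_partial_expectation.
  - by move=> k z; exact: partial_expectation_ge0.
  apply: eq_bigr => k _; rewrite [RHS](partial_expectation_tower indep x jA (gp0 k) (mgp k)).
  rewrite /processed supp_update_Some.
  have -> : ((j |: supp b) :|: ~: (j |: D) = A :|: [set j])%SET.
    by apply/setP => j'; rewrite !inE; case: (j' == j); rewrite ?orbT ?orbF.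
  apply: eq_partial_expectation => z; congr (_ `^ p).
  rewrite /g; apply: eq_big => [i|i _]; first exact: matches_update.
  suff -> : ((j |: D) :\: (j |: supp b) = D :\: supp b)%SET by [].
  apply/setP => j'; rewrite !inE.
  case: (j' =P j) => [->|_]//=; by rewrite (negbTE jD) andbF.
have ms1 : measurable_array_functional (fun z => (\sum_k pe [set j]%SET (g k) z) `^ p).
  by apply/measurable_array_functional_poweR/msum => k; exact: measurable_partial_expectation.
have ms2 : measurable_array_functional
    (fun z => \sum_(k < n) pe [set j]%SET (fun z => g k z `^ p) z).
  by apply: msum => k; exact: measurable_partial_expectation.
have mZ c F : measurable_array_functional F ->
    measurable_array_functional (fun z : 'I_n -> 'I_m -> S => c * F z).
  by move=> mF; apply: measurable_array_functionalM.
have s20 z : 0 <= \sum_(k < n) pe [set j]%SET (fun z => g k z `^ p) z.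
  by apply: sume_ge0 => k _; exact: partial_expectation_ge0.
rewrite -!partial_expectationZ//; last by move=> z; exact: poweR_ge0.
rewrite -partial_expectationD//; try exact: mZ;
  try by move=> z; rewrite mule_ge0 ?poweR_ge0 ?lee_fin.
apply: le_partial_expectation.
- by move=> z; apply: partial_expectation_ge0 => z'; exact: poweR_ge0.
- apply: measurable_partial_expectation; first by move=> z; exact: poweR_ge0.
  exact/measurable_array_functional_poweR/msum.
- by apply: measurable_array_functionalD; exact: mZ.
(* Locality of [H] shows that [g k] sees column [j] only in row [k]. *)
- move=> z; apply: partial_expectation_column_bound => // k y z' yz yz'.
  apply: eq_bigr => i /andP[_ /eqP ij]; apply: partial_expectation_local => j'.
  by case: (j' =P j) => [->|/eqP/yz' ->//]; rewrite ij.
Qed.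

(** The constant accumulated over [D]: [C1] for each column averaged inside the power, [C2] for each
    one pulled out. *)
Definition weight D b : R := (\prod_(j in D) if b j == None then C1 else C2)%R.

Let weight_ge0 D b : (0 <= weight D b)%R.
Proof. by apply: prodr_ge0 => j _; case: ifP. Qed.

Lemma weight_update D b j o : j \notin D ->
  weight (j |: D)%SET (update b j o) = ((if o == None then C1 else C2) * weight D b)%R.
Proof.
move=> jD; rewrite /weight big_setU1//= ffunE eqxx; congr (_ * _)%R.
apply: eq_bigr => j' j'D; rewrite ffunE; case: (j' =P j) => // j'j.
by rewrite -j'j j'D in jD.
Qed.

(** Induction on the size of [D], one column being added by [processed_step]. *)
Lemma processed_le D x :
  processed finset.set0 [ffun=> None] x <=
  \sum_(b | supp b \subset D) (weight D b)%:E * processed D b x.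
Proof.
have [k] := ubnP #|D|; elim: k D => // k IHk D; rewrite ltnS => Dk.
have [->|/set0Pn[j jD]] := eqVneq D finset.set0.
  rewrite (bigD1 [ffun=> None])/=; last first.
    by apply/fintype.subsetP => j; rewrite !inE ffunE.
  rewrite {1}/weight finset.big_set0 mul1e leeDl//; apply: sume_ge0 => b _.
  by rewrite mule_ge0 ?processed_ge0 ?lee_fin.
have [D' jD' DE] : exists2 D' : {set 'I_m}, j \notin D' & D = (j |: D')%SET.
  by exists (D :\ j)%SET; rewrite ?finset.setD1K// !inE eqxx.
rewrite {D jD}DE in Dk *; rewrite cardsU1 jD' in Dk.
apply: (le_trans (IHk D' Dk)).
rewrite [leRHS](sum_update _ jD').
apply: lee_sum => b bD.
have jb : j \notin supp b by apply: contra jD' => /(fintype.subsetP bD).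
apply: le_trans (lee_wpmul2l _ (processed_step x jD' bD)) _; first by rewrite lee_fin.
(* The undefined value at [j] gives the averaged term of the step, the values [k] give the terms
   pulled out. *)
rewrite big_option_fin/= weight_update//= update_None//.
under [X in _ <= (_ + X)%R]eq_bigr do rewrite weight_update//= EFinM -muleA.
rewrite -[X in _ <= (_ + X)%R]ge0_sume_distrr; last first.
  by move=> l _; rewrite mule_ge0 ?processed_ge0 ?lee_fin.
rewrite -ge0_sume_distrr; last by move=> l _; exact: processed_ge0.
rewrite ge0_muleDr ?mule_ge0 ?lee_fin ?processed_ge0//; last first.
  by apply: sume_ge0 => l _; exact: processed_ge0.
by rewrite [X in X + _ <= _]muleA [X in X * _ + _ <= _]muleC -EFinM [X in _ + X <= _]muleCA.
Qed.

End column_induction.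

(** * Brackets and moments of the given kernels *)

Section kernels.
Context d (Omega : measurableType d) (R : realType) (P : probability Omega R).
Context d' (S : measurableType d') (n m : nat).
Variable X : 'I_n -> 'I_m -> {RV P >-> S}.
Hypothesis indep : mutually_independent (fun kj : 'I_n * 'I_m => X kj.1 kj.2).
Variable h : m.-tuple 'I_n -> m.-tuple S -> R.
Hypothesis mh : forall i, measurable_fun setT (h i).
Hypothesis h0 : forall i u, 0 <= h i u.
Variable p : R.
Hypothesis p1 : 1 < p.
Local Open Scope ereal_scope.
Local Notation pe := (partial_expectation X).

Let H i (z : 'I_n -> 'I_m -> S) : \bar R := (h i (select i z))%:E.

Let H0 i z : 0 <= H i z. Proof. by rewrite lee_fin. Qed.

Let mH i : measurable_array_functional (H i).
Proof.
move=> d1 U Y mY; apply/measurable_EFinP; apply: (measurableT_comp (mh i)).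
apply/measurable_fun_tnthP => j.
have -> : @tnth m S ^~ j \o (fun u => select i (fun k j => Y (k, j) u)) = Y (tnth i j, j).
  by apply/funext => u /=; rewrite tnth_mktuple.
exact: mY.
Qed.

Let H_local i y z : (forall j, y (tnth i j) j = z (tnth i j) j) -> H i y = H i z.
Proof.
move=> yz; rewrite /H; congr (h i _)%:E.
by apply: eq_from_tnth => j; rewrite !tnth_mktuple.
Qed.

(** Once all columns are processed, a summand of the bracket of [J] is a state whose partial
    multi-index has support [J]. *)
Lemma bracketE J x :
  bracket X p h J x = \sum_(b | supp b == J) processed X H p finset.setT b x.
Proof.
rewrite sum_supp; apply: eq_bigr => a _.
rewrite /processed supp_extend finset.setCT finset.setU0 finset.setTD.
by apply: eq_partial_expectation => y; under [in RHS]eq_bigl do rewrite matches_extend.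
Qed.

Lemma bracket_ge0 J x : 0 <= bracket X p h J x.
Proof. by rewrite bracketE; apply: sume_ge0 => b _; exact: processed_ge0. Qed.

Lemma expectation_partial x :
  'E_P[fun w => ((\sum_(i : m.-tuple 'I_n) h i (rv_vector X i w)) `^ p)%R] =
  pe finset.setT (fun z => (\sum_i H i z) `^ p) x.
Proof.
rewrite partial_expectation_setT unlock; apply: eq_integral => w _.
by rewrite /H sumEFin poweR_EFin.
Qed.

(** Before any processing the partial multi-index is nowhere defined, so every multi-index matches
    it and nothing is averaged inside the power. *)
Lemma expectation_processed x :
  'E_P[fun w => ((\sum_(i : m.-tuple 'I_n) h i (rv_vector X i w)) `^ p)%R] =
  processed X H p finset.set0 [ffun=> None] x.
Proof.
rewrite (expectation_partial x) /processed; set b := [ffun=> None].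
have b0 : supp b = finset.set0 by apply/setP => j; rewrite !inE ffunE.
rewrite b0 finset.set0U finset.setC0 finset.set0D.
apply: eq_partial_expectation => z; congr (_ `^ p); apply: eq_big => [i|i _].
  by apply/esym/forallP => j; rewrite ffunE.
by rewrite partial_expectation_set0.
Qed.

Lemma bracket_le_expectation J x : bracket X p h J x <=
  'E_P[fun w => ((\sum_(i : m.-tuple 'I_n) h i (rv_vector X i w)) `^ p)%R].
Proof.
pose G (a : {ffun {j : 'I_m | j \in J} -> 'I_n}) z :=
  \sum_(i : m.-tuple 'I_n | del_coords J i == a) H i z.
have G0 a z : 0 <= G a z by exact: sume_ge0.
have mG a : measurable_array_functional (G a) by exact: measurable_array_functional_sum.
have mGp a : measurable_array_functional (fun z => G a z `^ p).
  exact: measurable_array_functional_poweR.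
have Gp0 a z : 0 <= G a z `^ p by exact: poweR_ge0.
rewrite (expectation_partial x).
(* Jensen's inequality moves the expectation over the columns outside [J] out of the power. *)
apply: (@le_trans _ _ (\sum_a pe J (pe (~: J)%SET (fun z => G a z `^ p)) x)).
  apply: lee_sum => a _; apply: le_partial_expectation.
  - by move=> z; exact: poweR_ge0.
  - apply: measurable_array_functional_poweR; apply: measurable_array_functional_sum => i.
    by apply: measurable_partial_expectation => [z|]; [exact: (H0 i)|exact: (mH i)].
  - exact: measurable_partial_expectation.
  - move=> z; rewrite -(partial_expectation_sum X _ _ _ z H0 mH).
    exact: (jensen_partial_expectation X (~: J)%SET z p1 (G0 a) (mG a)).
have JJ : [disjoint J & (~: J)%SET]%B by rewrite -finset.setI_eq0 finset.setICr.
under eq_bigr => a _.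
  rewrite (partial_expectation_tower indep x JJ (Gp0 a) (mGp a)) finset.setUCr.
  over.
rewrite -partial_expectation_sum//; apply: le_partial_expectation.
- by move=> z; exact: sume_ge0.
- exact: measurable_array_functional_sum.
- by apply: measurable_array_functional_poweR; exact: measurable_array_functional_sum.
(* The classes [i_J = a] partition the multi-indices, so superadditivity applies pointwise. *)
- move=> z; rewrite (partition_big (@del_coords n m J) predT)//=.
  exact: poweR_sum_ge.
Qed.

(** Each column costs at most [c], with an extra factor [q] if it is pulled out. The two upper
    bounds use [q = p^p] and [q = 1]. *)
Lemma expectation_le_brackets (s c q : R) x : (0 < s)%R -> (0 <= q)%R ->
  ((2 * (1 + s) `^ (p - 1)) `^ p <= c)%R -> (2 * (1 + s^-1) `^ (p - 1) <= c * q)%R ->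
  'E_P[fun w => ((\sum_(i : m.-tuple 'I_n) h i (rv_vector X i w)) `^ p)%R] <=
  \sum_(J : {set 'I_m}) (c ^+ m * q ^+ #|J|)%:E * bracket X p h J x.
Proof.
move=> s0 q0 C1c C2cq; have c0 : (0 <= c)%R by rewrite (le_trans _ C1c)// powR_ge0.
rewrite (expectation_processed x).
apply: le_trans (processed_le indep H0 mH H_local p1 s0 finset.setT x) _.
rewrite (partition_big (@supp n m) predT)//=.
apply: lee_sum => J _; rewrite bracketE ge0_sume_distrr; last first.
  by move=> b _; exact: processed_ge0.
under eq_bigl do rewrite finset.subsetT.
apply: lee_sum => b /eqP bJ; apply: lee_wpmul2r; first exact: processed_ge0.
rewrite lee_fin.
have -> : (c ^+ m * q ^+ #|J| = \prod_j (c * (if b j == None then 1 else q)))%R.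
  rewrite big_split/= prodr_const card_ord -bJ; congr (_ * _)%R.
  rewrite (bigID (fun j => b j == None))/= big1 ?mul1r; last by move=> j ->.
  rewrite (eq_bigr (fun=> q)); last by move=> j /negbTE ->.
  by rewrite -prodr_const; apply: eq_bigl => j; rewrite inE.
rewrite /weight (eq_bigl predT); last by move=> j; rewrite inE.
apply: ler_prod => j _; case: ifP => _; rewrite ?mulr1 ?powR_ge0//.
by rewrite C2cq mulr_ge0 ?powR_ge0.
Qed.

End kernels.

(** * Constants *)

Section constants.
Context {R : realType}.
Implicit Types p s q x : R.

Lemma powR_1D_le_expR s q : 0 <= s -> 0 <= q -> (1 + s) `^ q <= expR (s * q).
Proof.
move=> s0 q0; rewrite expRM; apply: ge0_ler_powR => //.
- by rewrite nnegrE addr_ge0.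
- by rewrite nnegrE expR_ge0.
- exact: expR_ge1Dx.
Qed.

Lemma powRMn_exprn x p (m : nat) : 0 <= x -> x `^ (m%:R * p) = (x `^ p) ^+ m.
Proof. by move=> x0; rewrite mulrC powRrM powR_mulrn ?powR_ge0. Qed.

(** With this [s], [(1 + s)^(p - 1)] is at most [e], and [1 + 1/s = p], so the second constant is
    [2 p^(p - 1)]. *)
Lemma sum_form_constants p : 1 < p ->
  let s := (p - 1)^-1 in
  [/\ 0 < s, (2 * (1 + s) `^ (p - 1)) `^ p <= (2 * expR 1 ^+ 2) `^ p
    & 2 * (1 + s^-1) `^ (p - 1) <= (2 * expR 1 ^+ 2) `^ p * p `^ p].
Proof.
move=> p1 s; have q0 : 0 < p - 1 by rewrite subr_gt0.
have p0 : 0 < p by rewrite (lt_trans ltr01).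
have s0 : 0 < s by rewrite invr_gt0.
have e1 : 1 <= expR 1 :> R by rewrite -expR0 ler_expR.
have ee : expR 1 <= expR 1 ^+ 2 :> R by rewrite expr2 ler_peMl// expR_ge0.
have e2 : 1 <= expR 1 ^+ 2 :> R by apply: le_trans ee.
split=> //.
- apply: ge0_ler_powR; rewrite ?nnegrE ?mulr_ge0 ?powR_ge0 ?exprn_ge0 ?expR_ge0 ?(ltW p0)//.
  rewrite ler_pM2l//; apply: le_trans ee.
  by apply: le_trans (powR_1D_le_expR (ltW s0) (ltW q0)) _; rewrite mulVf ?gt_eqF.
- rewrite invrK addrC subrK; apply: ler_pM; rewrite ?powR_ge0//.
    apply: (@le_trans _ _ (2 * expR 1 ^+ 2)); first by rewrite ler_peMr.
    by rewrite le1r_powR ?(ltW p1)// -[leLHS]mulr1 ler_pM// ler1n.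
  by apply: ler_powR; rewrite ?(ltW p1)// gerBl.
Qed.

(** This [s] balances the two constants: [(1 + s)^(p - 1)] is at most the square root of [p], and
    [1 + 1/s] is at most [3 p / ln p]. The 6 is this 3 times the factor 2. *)
Lemma max_form_constants p : 1 < p ->
  let s := ln p / (2 * p) in
  [/\ 0 < s, (2 * (1 + s) `^ (p - 1)) `^ p <= (6 * (p / ln p)) `^ p
    & 2 * (1 + s^-1) `^ (p - 1) <= (6 * (p / ln p)) `^ p].
Proof.
move=> p1 s; have q0 : 0 < p - 1 by rewrite subr_gt0.
have p0 : 0 < p by rewrite (lt_trans ltr01).
have L0 : 0 < ln p by rewrite ln_gt0.
have s0 : 0 < s by rewrite divr_gt0// mulr_gt0.
have Lp : ln p <= p by exact/ltW/ln_sublinear.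
have t1 : 1 <= p / ln p by rewrite ler_pdivlMr// mul1r.
split=> //.
- apply: ge0_ler_powR; rewrite ?nnegrE ?mulr_ge0 ?powR_ge0 ?invr_ge0 ?(ltW p0) ?(ltW L0)//.
  apply: (@le_trans _ _ (2 * expR (ln p / 2))).
    rewrite ler_pM2l//; apply: le_trans (powR_1D_le_expR (ltW s0) (ltW q0)) _.
    rewrite ler_expR /s.
    have -> : ln p / (2 * p) * (p - 1) = ln p / 2 - ln p / (2 * p) by field; rewrite gt_eqF.
    by rewrite gerBl divr_ge0 ?mulr_ge0 ?(ltW p0) ?(ltW L0).
  rewrite mulrA ler_pdivlMr//.
  (* [u] is the square root of [p]; since [1 + ln p / 2 <= u], the product [2 u ln p] is at most
     [6 u^2]. *)
  have := expR_ge1Dx (ln p / 2); set u := expR _ => u1.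
  have pu : p = u * u by rewrite -expRD -splitr lnK.
  have u0 : 0 < u by exact: expR_gt0.
  rewrite [in leRHS]pu; nra.
- apply: (@le_trans _ _ (2 * (3 * (p / ln p)) `^ (p - 1))).
    rewrite ler_pM2l//; apply: ge0_ler_powR; rewrite ?nnegrE ?(ltW q0)//.
    + by rewrite addr_ge0// invr_ge0 ltW.
    + by rewrite mulr_ge0// (le_trans _ t1).
    have -> : s^-1 = 2 * (p / ln p) by rewrite /s invf_div; field; rewrite gt_eqF.
    lra.
  have -> : 6 * (p / ln p) = 2 * (3 * (p / ln p)) by ring.
  have t3 : 1 <= 3 * (p / ln p) by lra.
  rewrite [leRHS]powRM ?(le_trans _ t3)//; apply: ler_pM; rewrite ?powR_ge0//.
    by rewrite le1r_powR ?(ltW p1)// ler1n.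
  by apply: ler_powR => //; rewrite gerBl.
Qed.
End constants.

(** * The three bounds, with an explicit universal constant *)

Unset Implicit Arguments.
Set Strict Implicit.
Set Printing Implicit Defensive.

Theorem proposition2p1 (R : realType) :
  exists K : R, 0 < K /\
  forall (d : measure_display) (Omega : measurableType d)
    (P : probability Omega R)
    (d' : measure_display) (S : measurableType d')
    (n m : nat) (X : 'I_n -> 'I_m -> {RV P >-> S})
    (p : R) (h : m.-tuple 'I_n -> m.-tuple S -> R),
  mutually_independent (fun kj : 'I_n * 'I_m => X kj.1 kj.2) ->
  (m <= n)%N ->
  1 < p ->
  (forall i, measurable_fun setT (h i)) ->
  (forall i s, 0 <= h i s) ->
  (forall i, (distribution P (rv_vector X i)).-integrable setT
     (fun s => (h i s `^ p)%:E)) ->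
  forall x : 'I_n -> 'I_m -> S,
  let moment :=
    'E_P[fun w => ((\sum_(i : m.-tuple 'I_n) h i (rv_vector X i w)) `^ p)%R]%E in
  [/\ (\big[maxe/-oo]_(J : {set 'I_m}) bracket X p h J x <= moment)%E,
      (moment <= ((2 * expR 1 ^+ 2) `^ (m%:R * p))%:E *
         \sum_(J : {set 'I_m})
            (p `^ (#|J|%:R * p))%:E * bracket X p h J x)%E
    & (moment <= (K `^ (m%:R * p))%:E * ((p / ln p) `^ (m%:R * p))%:E *
         \big[maxe/-oo]_(J : {set 'I_m}) bracket X p h J x)%E ].
Proof.
(* Here 12 is 6, from the constants of the maximum form, times 2, which pays for the number of
   brackets. *)
exists 12%:R; split=> // d Omega P d' S n m X p h indep _ p1 mh h0 _ x moment.
have p0 : 0 < p by rewrite (lt_trans ltr01).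
have e0 : 0 <= 2 * expR 1 ^+ 2 :> R by rewrite mulr_ge0// exprn_ge0// expR_ge0.
have t0 : 0 <= p / ln p by rewrite divr_ge0 ?ln_ge0// ltW.
split.
- apply: bigmax_le; first exact: leNye.
  by move=> J _; exact: bracket_le_expectation.
- have [s0 C1 C2] := sum_form_constants p1.
  apply: le_trans (expectation_le_brackets indep mh h0 p1 x s0 (powR_ge0 _ _) C1 C2) _.
  rewrite ge0_sume_distrr; last first.
    by move=> J _; rewrite mule_ge0 ?bracket_ge0// lee_fin powR_ge0.
  apply: lee_sum => J _; rewrite muleA -EFinM !powRMn_exprn// ltW//.
- have [s0 C1 C2] := max_form_constants p1.
  rewrite -[leRHS]mulr1 in C2.
  apply: le_trans (expectation_le_brackets indep mh h0 p1 x s0 ler01 C1 C2) _.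
  set M := (\big[maxe/-oo]_(J : {set 'I_m}) bracket X p h J x)%E.
  have M0 : (0 <= M)%E.
    (* The maximum starts from [-oo]; the bracket of the empty set shows that it is nonnegative. *)
    apply: (@le_trans _ _ (bracket X p h finset.set0 x)); first exact: bracket_ge0.
    exact: le_bigmax.
  set c := ((6 * (p / ln p)) `^ p) ^+ m.
  have c0 : 0 <= c by rewrite exprn_ge0// powR_ge0.
  apply: (@le_trans _ _ (\sum_(J : {set 'I_m}) (c%:E * M))%E).
    apply: lee_sum => J _; rewrite expr1n mulr1; apply: lee_wpmul2l; first by rewrite lee_fin.
    exact: le_bigmax.
  rewrite -ge0_sume_distrl; last by move=> *; rewrite lee_fin.
  rewrite sumEFin sumr_const -EFinM; apply: lee_wpmul2r => //; rewrite lee_fin.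
  (* Bounding every bracket by the maximum costs a factor [2^m], which is at most [2^(m p)] since
     [p > 1]. *)
  have -> : #|{: {set 'I_m}}| = (2 ^ m)%N.
    by rewrite -cardsT -finset.powersetT card_powerset cardsT card_ord.
  rewrite -[c *+ _]mulr_natr natrX !powRMn_exprn// -exprMn -exprMn.
  apply: lerXn2r; rewrite ?nnegrE ?mulr_ge0 ?powR_ge0//.
  rewrite powRM// -[12%:R](_ : 6 * 2 = _ :> R); last by ring.
  rewrite [(6 * 2) `^ p]powRM// mulrAC.
  apply: ler_wpM2r; first exact: powR_ge0.
  apply: ler_wpM2l; first exact: powR_ge0.
  by rewrite le1r_powR ?(ltW p1)// ler1n.
Qed.
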